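(* Suppose that $\bar X\in\mathbb{R}^{m\times n}$ is a local minimizer of the problem $\min_{X\in\mathbb{R}^{m\times n}} \mathcal F(X):=f(X)+\lambda\Phi(X)$. Then $\bar X$ is a lifted stationary point of this problem.
   Context: Let $n\le m$ be positive integers. For $X\in\mathbb{R}^{m\times n}$, $\sigma(X)=(\sigma_1(X),\dots,\sigma_n(X))^T$ is the vector of singular values with $\sigma_1(X)\ge\dots\ge\sigma_n(X)\ge0$. For $x\in\mathbb{R}^n$, $\mathscr D(x)$ is the diagonal $m\times n$ matrix with diagonal $x$; $E_i=\mathscr D(e_i)$ with $e_i$ the $i$th standard unit vector. $\mathcal M(X)=\{(U,V): U\in\mathbb{R}^{m\times m},\,V\in\mathbb{R}^{n\times n}\text{ orthogonal},\ X=U\mathscr D(\sigma(X))V^T\}$. Standing assumptions: $\lambda>0$; $f:\mathbb{R}^{m\times n}\to[0,\infty)$ is convex (not necessarily smooth) and Lipschitz continuous with constant $L_f>0$ with respect to the Frobenius norm; the parameter $\nu$ satisfies $0<\nu<\bar\nu:=\lambda/L_f$. $\partial f$ is the subdifferential of $f$ (with respect to $\langle X,Y\rangle=\operatorname{tr}(XY^T)$). $\Phi(X)=\sum_{i=1}^n\phi(\sigma_i(X))$, where $\phi(t)=\min\{1,t/\nu\}$ for $t\ge0$. Let $\theta_1(t)=0$, $\theta_2(t)=t/\nu-1$ (so $\phi(t)=t/\nu-\max\{\theta_1(t),\theta_2(t)\}$) and $\mathcal D(t)=\{i\in\{1,2\}:\theta_i(t)=\max\{\theta_1(t),\theta_2(t)\}\}$.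 $X$ is a lifted stationary point of $\min \mathcal F$ if there exist $d_i\in\mathcal D(\sigma_i(X))$, $i=1,\dots,n$, such that $$\lambda\sum_{i=1}^n\theta_{d_i}'(\sigma_i(X))E_i\in\Big\{U^T\partial f(X)V+\tfrac{\lambda}{\nu}\mathscr D(\partial\|\sigma(X)\|_1):(U,V)\in\mathcal M(X)\Big\},$$ i.e. there are $(U,V)\in\mathcal M(X)$, $\xi\in\partial f(X)$ and $s\in\partial\|\cdot\|_1(\sigma(X))$ (the subdifferential of the $\ell_1$ norm on $\mathbb{R}^n$ at $\sigma(X)$) with $\lambda\sum_i\theta_{d_i}'(\sigma_i(X))E_i=U^T\xi V+\frac{\lambda}{\nu}\mathscr D(s)$. *)

(* Defs.v *)
From HB Require Import structures.
From mathcomp Require Import all_boot all_order all_algebra.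
From mathcomp Require Import polyrcf.
From mathcomp Require Import all_classical all_reals all_analysis.

Set Implicit Arguments.
Unset Strict Implicit.
Unset Printing Implicit Defensive.

Import Order.TTheory GRing.Theory Num.Theory.
Import numFieldNormedType.Exports.

Local Open Scope classical_set_scope.
Local Open Scope ring_scope.

Section MatrixNotions.
Context {R : realType} {m n : nat}.
Implicit Types (X Y : 'M[R]_(m, n)) (x : 'cV[R]_n).

Definition frob_inner X Y : R := \tr (X *m Y^T).

(* The library norm on matrices is the maximum of the absolute entries. *)
Definition frob_norm X : R := Num.sqrt (frob_inner X X).

Definition frob_lipschitz (L : R) (f : 'M[R]_(m, n) -> R) : Prop :=
  forall X Y, `|f X - f Y| <= L * frob_norm (X - Y).

Definition subdiff (g : 'M[R]_(m, n) -> R) X : set 'M[R]_(m, n) :=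
  [set G | forall Y, g X + frob_inner G (Y - X) <= g Y].

Definition diagm x : 'M[R]_(m, n) :=
  \matrix_(i < m, j < n) (if i == j :> nat then x j 0 else 0).

Definition Ediag (i : 'I_n) : 'M[R]_(m, n) := diagm (delta_mx i 0).

(* [rootsR] lists the distinct real roots of a polynomial, so each one is
   repeated [mup] many times. *)
Definition gram_eigenvalues X : seq R :=
  let p := char_poly (X^T *m X) in
  flatten [seq nseq (mup a p) a | a <- rootsR p].

(* For [n <= m], the singular values are the square roots of the [n]
   eigenvalues of [X^T *m X], in nonincreasing order. *)
Definition singval X : 'cV[R]_n :=
  \col_i Num.sqrt (sort >=%R (gram_eigenvalues X))`_i.

End MatrixNotions.

Definition orthogonalmx {R : realType} {k : nat} : set 'M[R]_k :=
  [set U | U^T *m U = 1%:M].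

Definition svd_pairs {R : realType} {m n : nat} (X : 'M[R]_(m, n)) :
    set ('M[R]_m * 'M[R]_n) :=
  [set UV | [/\ orthogonalmx UV.1, orthogonalmx UV.2 &
                X = UV.1 *m diagm (singval X) *m UV.2^T]].

Definition l1norm {R : realType} {n : nat} (x : 'cV[R]_n) : R :=
  \sum_i `|x i 0|.

Section LiftedStationarity.
Context {R : realType}.
Variable nu : R.

Definition phi (t : R) : R := Num.min 1 (t / nu).

(* Indices 0 and 1 of ['I_2] stand for the indices 1 and 2. *)
Definition theta (k : 'I_2) (t : R) : R :=
  if k == 0 then 0 else t / nu - 1.

Definition active (t : R) : set 'I_2 :=
  [set k | theta k t = Num.max (theta 0 t) (theta 1 t)].

Definition Phi {m n : nat} (X : 'M[R]_(m, n)) : R :=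
  \sum_i phi (singval X i 0).

Definition lifted_stationary {m n : nat} (lambda : R)
    (f : 'M[R]_(m, n) -> R) (X : 'M[R]_(m, n)) : Prop :=
  exists2 d : 'I_n -> 'I_2,
    forall i, active (singval X i 0) (d i) &
    exists UV xi s,
      [/\ svd_pairs X UV, subdiff f X xi, subdiff l1norm (singval X) s &
          lambda *: \sum_i (derive1 (theta (d i)) (singval X i 0) *: Ediag i) =
          UV.1^T *m xi *m UV.2 + (lambda / nu) *: diagm s].

End LiftedStationarity.

(* Main.v *)
Require Import Defs.
From mathcomp Require Import all_boot all_order all_algebra.
From mathcomp Require Import ring lra.
From mathcomp Require Import polyrcf.
From mathcomp Require Import all_classical all_reals all_analysis.

Set Implicit Arguments.
Unset Strict Implicit.
Unset Printing Implicit Defensive.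

Import Order.TTheory GRing.Theory Num.Theory.
Import numFieldNormedType.Exports.

Local Open Scope classical_set_scope.
Local Open Scope ring_scope.

(** Let r be the rank of the local minimiser X.  Two perturbations of X decide
    everything.

    Decreasing one singular value: along -U E_i V^T, for an SVD X = U D(x) V^T
    with 0 < x_i < nu, the term lambda * Phi falls at rate lambda / nu, whereas f
    grows at rate at most L < lambda / nu.  Hence every singular value is 0
    or at least nu ([singval_gap]), and Phi(X) = r, while Phi(Y) <= rank Y for
    every Y because phi <= 1 and phi(0) = 0 ([Phi_le_rank]).

    Moving along the matrices of rank at most r: the curve
    (1 + t Q) X (1 + t P) never raises the rank, so Phi cannot increase along it,
    and f must be at least f(X) up to an error O(t^2).  Convexity and the Lipschitz
    bound turn this into f(X) <= f(X + H) for every H = Q X + X P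
    ([local_min_on_tangent]): X minimises f on its affine tangent space.  A
    Hahn-Banach argument ([subgradient_vanishing_on]) then gives G in the
    subdifferential of f at X that is orthogonal to all these H, that is
    X^T G = 0 and X G^T = 0 ([subgradient_normal_to_tangent]).

    The two equations say that X and G have orthogonal row spaces and orthogonal
    column spaces, so one pair (U, V) diagonalises both, X = U D(x) V^T and
    G = U D(y) V^T with x_i y_i = 0 ([svd_orthogonal_pair]).  The Lipschitz
    constant bounds |y_i| by L < lambda / nu ([subdiff_lipschitz_bound]).  The
    stationarity equation is now diagonal: where x_i > 0 one takes
    d_i = 2 and s_i = 1, and where x_i = 0 one takes d_i = 1 and
    s_i = - nu y_i / lambda, which lies in [-1, 1]. *)

(** * Orthogonal matrices *)

Section OrthogonalMatrices.
Context {R : realType}.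

Lemma orthogonalmxVr k (U : 'M[R]_k) : orthogonalmx U -> U *m U^T = 1%:M.
Proof. exact: mulmx1C. Qed.

Lemma orthogonalmx1 k : orthogonalmx (1%:M : 'M[R]_k).
Proof. by rewrite /orthogonalmx /= trmx1 mulmx1. Qed.

Lemma orthogonalmx_tr k (U : 'M[R]_k) : orthogonalmx U -> orthogonalmx U^T.
Proof. by move=> /orthogonalmxVr UU; rewrite /orthogonalmx /= trmxK. Qed.

Lemma orthogonalmxM k (U V : 'M[R]_k) :
  orthogonalmx U -> orthogonalmx V -> orthogonalmx (U *m V).
Proof.
rewrite /orthogonalmx /= => UU VV.
by rewrite trmx_mul mulmxA -(mulmxA V^T) UU mulmx1.
Qed.

Lemma orthogonalmx_block k (U : 'M[R]_k) : orthogonalmx U ->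
  orthogonalmx (block_mx 1%:M 0 0 U : 'M[R]_(1 + k)).
Proof.
rewrite /orthogonalmx /= => UU.
rewrite tr_block_mx mulmx_block !trmx0 trmx1.
by rewrite !(mulmx0, mul0mx, mulmx1, addr0, add0r) UU -scalar_mx_block.
Qed.

Definition sqnorm k (v : 'rV[R]_k) : R := (v *m v^T) 0 0.

Lemma sqnormE k (v : 'rV[R]_k) : sqnorm v = \sum_j v 0 j ^+ 2.
Proof. by rewrite /sqnorm mxE; apply: eq_bigr => j _; rewrite mxE expr2. Qed.

Lemma sqnorm_ge0 k (v : 'rV[R]_k) : 0 <= sqnorm v.
Proof. by rewrite sqnormE; apply: sumr_ge0 => j _; exact: sqr_ge0. Qed.

Lemma sqnorm_eq0 k (v : 'rV[R]_k) : (sqnorm v == 0) = (v == 0).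
Proof.
apply/idP/eqP => [|->]; last by rewrite /sqnorm mul0mx mxE.
rewrite sqnormE psumr_eq0 => [/allP v0|j _]; last exact: sqr_ge0.
apply/rowP => j; rewrite mxE; apply/eqP.
by have := v0 j (mem_index_enum j); rewrite sqrf_eq0.
Qed.

Lemma sqnormZ k a (v : 'rV[R]_k) : sqnorm (a *: v) = a ^+ 2 * sqnorm v.
Proof. by rewrite /sqnorm linearZ /= -scalemxAl -scalemxAr !mxE mulrA expr2. Qed.

Lemma sqnorm_orthogonal k (v : 'rV[R]_k) (U : 'M[R]_k) :
  orthogonalmx U -> sqnorm (v *m U) = sqnorm v.
Proof.
move=> /orthogonalmxVr UU.
by rewrite /sqnorm trmx_mul mulmxA -(mulmxA v) UU mulmx1.
Qed.

(** The Householder reflection exchanging the first basis vector e and u: with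
    w = e - u, the matrix 1 - 2 w^T w / |w|^2 is symmetric and involutive, and
    since e w^T = |w|^2 / 2 it sends e to e - w = u. *)
Lemma orthogonalmx_first_row k (u : 'rV[R]_(1 + k)) : sqnorm u = 1 ->
  exists2 Q : 'M[R]_(1 + k), orthogonalmx Q & row_mx 1%:M 0 *m Q = u.
Proof.
move=> u1; set e : 'rV[R]_(1 + k) := row_mx 1%:M 0.
have e1 : sqnorm e = 1.
  by rewrite /sqnorm /e tr_row_mx mul_row_col trmx1 mulmx1 trmx0 mulmx0 addr0 mxE.
have [->|eu] := eqVneq u e.
  by exists 1%:M; [exact: orthogonalmx1 | rewrite mulmx1].
pose w := e - u; set a := sqnorm w.
have a0 : a != 0 by rewrite sqnorm_eq0 subr_eq0 eq_sym.
have wwE : w *m w^T = a%:M by rewrite [LHS]mx11_scalar.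
pose M := w^T *m w.
have MT : M^T = M by rewrite /M trmx_mul trmxK.
have MM : M *m M = a *: M.
  by rewrite /M mulmxA -(mulmxA w^T w) wwE mul_mx_scalar scalemxAl.
exists (1%:M - (2 / a) *: M).
  clearbody M; rewrite /orthogonalmx /= [(_ - _)^T]linearB /= [(_ *: _)^T]linearZ /= trmx1 MT.
  rewrite mulmxBl mul1mx mulmxBr mulmx1 -scalemxAl -scalemxAr MM !scalerA.
  rewrite -addrA -opprD -[RHS]subr0; congr (_ - _).
  rewrite addrA -scalerDl -scalerBl.
  rewrite (_ : _ - _ = 0) ?scale0r//.
  by field.
have ewE : e *m w^T = (a / 2)%:M.
  have uuE : u *m u^T = 1%:M by rewrite [LHS]mx11_scalar -/(sqnorm u) u1.
  have eeE : e *m e^T = 1%:M by rewrite [LHS]mx11_scalar -/(sqnorm e) e1.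
  have ueE : u *m e^T = e *m u^T by rewrite [LHS]mx11_scalar -[RHS]trmxK
    trmx_mul trmxK [u *m _]mx11_scalar tr_scalar_mx !mxE.
  have : a%:M = (1%:M - e *m u^T) *+ 2 :> 'M[R]_1.
    by rewrite -wwE /w [(_ - _)^T]linearB /= mulmxBl !mulmxBr uuE eeE ueE opprB addrC -mulr2n addrC.
  rewrite /w [(_ - _)^T]linearB /= mulmxBr eeE => /(congr1 (fun A => (2^-1 : R) *: A)).
  rewrite /= scale_scalar_mx mulrC => ->; rewrite -scalerMnr scalerMnl -mulr_natr.
  by rewrite mulVf ?scale1r// pnatr_eq0.
rewrite mulmxBr mulmx1 -scalemxAr /M mulmxA ewE mul_scalar_mx scalerA.
have -> : 2 / a * (a / 2) = 1 by field.
by rewrite scale1r /w opprB addrC subrK.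
Qed.
End OrthogonalMatrices.

(** * Singular value decomposition *)

Section SingularValueDecomposition.
Context {R : realType}.

Lemma continuous_sum (T : topologicalType) I (r : seq I) (F : I -> T -> R) :
  (forall i, continuous (F i)) -> continuous (fun x => \sum_(i <- r) F i x).
Proof.
by move=> cF; apply: continuous_big => [|i _]; [exact: add_continuous | exact: cF].
Qed.

Lemma continuous_sqnorm_mulmx m n (X : 'M[R]_(m, n)) :
  continuous (fun v : 'rV[R]_m => sqnorm (v *m X)).
Proof.
move=> v; rewrite (_ : (fun _ => _) =
    fun w : 'rV[R]_m => \sum_j (\sum_i w 0 i * X i j) ^+ 2); last first.
  by apply/funext => w; rewrite sqnormE; apply: eq_bigr => j _; rewrite mxE.
apply: continuous_sum => j {}v.
apply: (@continuous_comp _ _ _ (fun w : 'rV[R]_m => \sum_i w 0 i * X i j)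
  (fun t : R => t ^+ 2)); last exact: exprn_continuous.
apply: continuous_sum => i {}v.
apply: (@continuousM _ _ (fun w : 'rV[R]_m => w 0 i) (fun=> X i j)).
  exact: coord_continuous.
exact: cst_continuous.
Qed.

(** The operator norm is attained, by compactness of the unit sphere. *)
Lemma max_sqnorm_mulmx m n (X : 'M[R]_(m.+1, n)) :
  exists2 u : 'rV[R]_m.+1, sqnorm u = 1 &
    forall v, sqnorm (v *m X) <= sqnorm (u *m X) * sqnorm v.
Proof.
pose A := [set v : 'rV[R]_m.+1 | sqnorm v = 1].
have A0 : A !=set0.
  exists (delta_mx 0 0); rewrite /A /= sqnormE (bigD1 ord0)//= mxE !eqxx expr1n.
  by rewrite big1 ?addr0// => i /negbTE i0; rewrite mxE i0 andbF expr0n.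
have cA : compact A.
  apply: bounded_closed_compact.
    exists 1; split => // M M1 v /= v1; rewrite [leLHS]/Num.norm /= mx_normrE.
    apply: bigmax_le => [|[i j] _ /=]; first by rewrite (le_trans _ (ltW M1)).
    apply: le_trans (ltW M1); rewrite -(@ler_pXn2r _ 2) ?nnegrE// expr1n.
    rewrite real_normK ?num_real// -v1 sqnormE ord1.
    by rewrite (bigD1 j)//= lerDl sumr_ge0// => k _; exact: sqr_ge0.
  rewrite (_ : A = (fun v => sqnorm (v *m 1%:M)) @^-1` [set 1]).
    by apply: preimage_closed => [v _|]; [exact: continuous_sqnorm_mulmx | exact: closed_eq].
  by apply/seteqP; split => v; rewrite /A /= mulmx1.
have [u uA umax] := EVT_max_rV A0 cA
  (continuous_subspaceT (@continuous_sqnorm_mulmx _ _ X)).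
exists u; first by move: uA; rewrite inE.
move=> v; have [->|v0] := eqVneq v 0.
  by rewrite mul0mx /sqnorm !mul0mx mxE mulr0.
have nv0 : 0 < sqnorm v by rewrite lt_def sqnorm_eq0 v0 sqnorm_ge0.
pose c := (Num.sqrt (sqnorm v))^-1.
have c2 : c ^+ 2 = (sqnorm v)^-1 by rewrite exprVn sqr_sqrtr// sqnorm_ge0.
have := umax (c *: v); rewrite inE /A /= sqnormZ c2 mulVf ?gt_eqF//.
move=> /(_ erefl); rewrite -scalemxAl sqnormZ c2 => h.
by rewrite -ler_pdivrMr// mulrC.
Qed.

Lemma sqnorm_row_mx m n (a : 'rV[R]_m) (b : 'rV[R]_n) :
  sqnorm (row_mx a b) = sqnorm a + sqnorm b.
Proof. by rewrite /sqnorm tr_row_mx mul_row_col mxE. Qed.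

Lemma sqnorm_scalar (a : R) : sqnorm (a%:M : 'rV[R]_1) = a ^+ 2.
Proof. by rewrite /sqnorm tr_scalar_mx -scalar_mxM mxE expr2. Qed.

(** Splitting off the largest singular value s.  Let u be a unit row vector
    at which |u X| attains its maximum s, and v the unit vector along u X.
    In orthonormal bases starting with u and v, the first row of X is (s, 0), and
    the first column is (s, 0)^T as well, because a nonzero remainder c would give
    the vector (s, c^T) a stretching factor above s.  The bound on the remaining
    block is what makes the singular values found by induction sorted. *)
Lemma svd_deflation m n (X : 'M[R]_(1 + m, 1 + n)) :
  exists (P : 'M[R]_(1 + m)) (Q : 'M[R]_(1 + n)) (s : R) (X' : 'M[R]_(m, n)),
  [/\ orthogonalmx P, orthogonalmx Q, 0 <= s,
      X = P *m block_mx s%:M 0 0 X' *m Q^T &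
      forall v, sqnorm (v *m X') <= s ^+ 2 * sqnorm v].
Proof.
have [u u1 umax] := max_sqnorm_mulmx X.
set e := sqnorm _ in umax; pose s := Num.sqrt e.
have s2 : s ^+ 2 = e by rewrite sqr_sqrtr// sqnorm_ge0.
have s0 : 0 <= s := sqrtr_ge0 e.
have [s_eq0|s_neq0] := eqVneq s 0.
  have X0 : X = 0.
    apply/row_matrixP => i; apply/eqP; rewrite row0 rowE -sqnorm_eq0.
    rewrite eq_le sqnorm_ge0 andbT (le_trans (umax _))// -s2 s_eq0.
    by rewrite expr0n mul0r.
  exists 1%:M, 1%:M, 0, 0; split => //; try exact: orthogonalmx1.
    rewrite X0 mul1mx trmx1 mulmx1.
    by rewrite (_ : 0%:M = 0) ?block_mx0//; apply/matrixP => i j; rewrite !mxE mul0rn.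
  by move=> v; rewrite mulmx0 /sqnorm mul0mx mxE expr0n mul0r.
pose v : 'rV[R]_(1 + n) := s^-1 *: (u *m X).
have v1 : sqnorm v = 1 by rewrite sqnormZ exprVn s2 mulVf// -s2 expf_neq0.
have [P PO Pu] := orthogonalmx_first_row u1.
have [Q QO Qv] := orthogonalmx_first_row v1.
pose Z := P *m X *m Q^T.
have Zmax w : sqnorm (w *m Z) <= e * sqnorm w.
  rewrite /Z !mulmxA sqnorm_orthogonal; last exact: orthogonalmx_tr.
  by rewrite (le_trans (umax _))// sqnorm_orthogonal.
have Ztop : row_mx 1%:M 0 *m Z = row_mx s%:M 0.
  rewrite /Z !mulmxA Pu (_ : u *m X = s *: v).
    rewrite -Qv -scalemxAl -mulmxA orthogonalmxVr// mulmx1 scale_row_mx.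
    by rewrite scalemx1 scaler0.
  by rewrite scalerA mulfV// scale1r.
have := Ztop; rewrite -(submxK Z) mul_row_block !mul1mx !mul0mx !addr0.
move=> /eq_row_mx[Zul Zur].
have Zdl : dlsubmx Z = 0.
  set c := dlsubmx Z.
  (* The product of this vector with the first column alone has square norm
     (s^2 + |c|^2)^2, while maximality allows at most s^2 (s^2 + |c|^2). *)
  have := Zmax (row_mx s%:M c^T); rewrite -[in leLHS](submxK Z) mul_row_block.
  rewrite Zul Zur !sqnorm_row_mx sqnorm_scalar -/c mulmx0 add0r.
  have -> : s%:M *m s%:M + c^T *m c = (s ^+ 2 + sqnorm c^T)%:M.
    by rewrite -scalar_mxM raddfD /= expr2 /sqnorm trmxK -mx11_scalar.
  rewrite sqnorm_scalar s2 => h.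
  have := le_trans _ h => /(_ ((e + sqnorm c^T) ^+ 2)).
  rewrite lerDl sqnorm_ge0 => /(_ isT).
  have e0 : 0 < e by rewrite -s2 exprn_gt0// lt_def s_neq0.
  have := sqnorm_ge0 c^T => c0; rewrite expr2 ler_pM2r; last by rewrite ltr_wpDr.
  rewrite gerDl => c0'.
  by rewrite -[LHS]trmxK (_ : c^T = 0) ?trmx0//; apply/eqP; rewrite -sqnorm_eq0 eq_le c0' c0.
exists P^T, Q^T, s, (drsubmx Z); split => //; try exact: orthogonalmx_tr.
  have -> : block_mx s%:M 0 0 (drsubmx Z) = Z by rewrite -[RHS]submxK Zul Zur Zdl.
  rewrite /Z trmxK !mulmxA PO mul1mx -mulmxA.
  by rewrite QO mulmx1.
move=> w; have := Zmax (row_mx 0 w).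
rewrite -[in leLHS](submxK Z) mul_row_block Zdl !mul0mx mulmx0 !add0r.
by rewrite !sqnorm_row_mx /sqnorm !mul0mx !mxE !add0r s2.
Qed.

Lemma diagm_col_mx m n (s : R) (x : 'cV[R]_n) :
  diagm (col_mx s%:M x) = block_mx s%:M 0 0 (diagm x) :> 'M[R]_(1 + m, 1 + n).
Proof.
apply/matrixP => i j; rewrite !mxE.
case: (splitP i) => i' ->; rewrite !mxE; case: (splitP j) => j' ->; rewrite !mxE ?ord1 //=.
Qed.

Lemma diagm_border m n (s : R) (U : 'M[R]_m) (x : 'cV[R]_n) (V : 'M[R]_n) :
  block_mx s%:M 0 0 (U *m diagm x *m V^T) =
  (block_mx 1%:M 0 0 U : 'M[R]_(1 + m)) *m diagm (col_mx s%:M x : 'cV[R]_(1 + n))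
    *m (block_mx 1%:M 0 0 V : 'M[R]_(1 + n))^T.
Proof.
rewrite diagm_col_mx tr_block_mx !mulmx_block.
by rewrite !trmx0 !trmx1 !(mulmx0, mul0mx, mulmx1, mul1mx, addr0, add0r).
Qed.

Definition nonincreasing_cV n (x : 'cV[R]_n) :=
  forall i j : 'I_n, (i <= j)%N -> x j 0 <= x i 0.

Lemma nonincreasing_cV_col_mx n (s : R) (x : 'cV[R]_n) :
  (forall i, x i 0 <= s) -> nonincreasing_cV x -> nonincreasing_cV (col_mx s%:M x : 'cV[R]_(1 + n)).
Proof.
move=> xs xn i j; rewrite !mxE.
case: (splitP i) => i' ->; case: (splitP j) => j' ->; rewrite ?mxE ?ord1 //=.
by rewrite !add1n ltnS => /xn.
Qed.

Lemma svd_bound m n (U : 'M[R]_m) (V : 'M[R]_n) (x : 'cV[R]_n) (s : R) :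
  (n <= m)%N -> orthogonalmx U -> orthogonalmx V -> 0 <= s ->
  (forall v, sqnorm (v *m (U *m diagm x *m V^T)) <= s ^+ 2 * sqnorm v) ->
  forall i, x i 0 <= s.
Proof.
move=> nm UO VO s0 xs i.
have := xs (row (widen_ord nm i) U^T).
have /orthogonalmxVr VO' := VO.
rewrite rowE sqnorm_orthogonal; last exact: orthogonalmx_tr.
rewrite !mulmxA -(mulmxA _ U^T) UO mulmx1 sqnorm_orthogonal; last exact: orthogonalmx_tr.
have -> : delta_mx 0 (widen_ord nm i) *m diagm x = x i 0 *: delta_mx 0 i :> 'rV[R]_n.
  apply/rowP => j; rewrite -rowE !mxE /=.
  case: (eqVneq j i) => [->|]; first by rewrite eqxx mulr1.
  by rewrite mulr0 eq_sym -val_eqE => /negbTE /= ->.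
have nd k (j : 'I_k) : sqnorm (delta_mx 0 j) = 1.
  by rewrite /sqnorm trmx_delta mul_delta_mx mxE !eqxx.
rewrite sqnormZ !nd !mulr1 => h.
by rewrite (le_trans (ler_norm _))// -(@ler_pXn2r _ 2) ?nnegrE// real_normK ?num_real.
Qed.

Lemma svd_exists m n (X : 'M[R]_(m, n)) : (n <= m)%N ->
  exists (U : 'M[R]_m) (V : 'M[R]_n) (x : 'cV[R]_n),
  [/\ orthogonalmx U, orthogonalmx V, (forall i, 0 <= x i 0), nonincreasing_cV x &
      X = U *m diagm x *m V^T].
Proof.
elim: n m X => [|n IHn] [|m] X // nm.
- exists 1%:M, 1%:M, 0; split; try exact: orthogonalmx1.
  + by case.
  + by case.
  + by apply/matrixP => i [].
- exists 1%:M, 1%:M, 0; split; try exact: orthogonalmx1.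
  + by case.
  + by case.
  + by apply/matrixP => i [].
have [P [Q [s [X' [PO QO s0 XE X's]]]]] := svd_deflation (X : 'M[R]_(1 + m, 1 + n)).
have [U [V [x [UO VO x0 xn X'E]]]] := IHn m X' nm.
pose U' : 'M[R]_(1 + m) := block_mx 1%:M 0 0 U.
pose V' : 'M[R]_(1 + n) := block_mx 1%:M 0 0 V.
exists (P *m U'), (Q *m V'), (col_mx s%:M x : 'cV[R]_(1 + n)); split.
- by apply: orthogonalmxM => //; exact: orthogonalmx_block.
- by apply: orthogonalmxM => //; exact: orthogonalmx_block.
- by move=> i; rewrite !mxE; case: splitP => j _ //; rewrite mxE ord1.
- apply: nonincreasing_cV_col_mx => //; apply: (@svd_bound m n U V x s nm UO VO s0).
  by rewrite -X'E.
by rewrite XE X'E diagm_border trmx_mul !mulmxA.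
Qed.

(** When X and Y have orthogonal column spaces and orthogonal row spaces, the
    singular vectors of X for nonzero singular values are annihilated by Y.  The
    deflation of X therefore splits Y compatibly, with a zero corner, until X
    is exhausted; the remaining block of Y then has an SVD of its own, to which
    the zero block of X is indifferent.  The entries of y come in no
    particular order. *)
Lemma svd_orthogonal_pair m n (X Y : 'M[R]_(m, n)) : (n <= m)%N ->
  X^T *m Y = 0 -> X *m Y^T = 0 ->
  exists (U : 'M[R]_m) (V : 'M[R]_n) (x y : 'cV[R]_n),
  [/\ orthogonalmx U /\ orthogonalmx V, (forall i, 0 <= x i 0), nonincreasing_cV x,
      X = U *m diagm x *m V^T & Y = U *m diagm y *m V^T].
Proof.
elim: n m X Y => [|n IHn] [|m] X Y // nm XY YX.
- exists 1%:M, 1%:M, 0, 0; split; try by case.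
  + by split; exact: orthogonalmx1.
  + by apply/matrixP => i [].
  + by apply/matrixP => i [].
- exists 1%:M, 1%:M, 0, 0; split; try by case.
  + by split; exact: orthogonalmx1.
  + by apply/matrixP => i [].
  + by apply/matrixP => i [].
have [P [Q [s [X' [PO QO s0 XE X's]]]]] := svd_deflation (X : 'M[R]_(1 + m, 1 + n)).
have [s_eq0|s_neq0] := eqVneq s 0.
  have X'0 : X' = 0.
    apply/row_matrixP => i; apply/eqP; rewrite row0 rowE -sqnorm_eq0.
    by rewrite eq_le sqnorm_ge0 andbT (le_trans (X's _))// s_eq0 expr0n mul0r.
  have X0 : X = 0.
    rewrite XE X'0 s_eq0 (_ : 0%:M = 0) ?block_mx0 ?mulmx0 ?mul0mx//.
    by apply/matrixP => i j; rewrite !mxE mul0rn.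
  have [U [V [y [UO VO _ _ ->]]]] := svd_exists Y nm.
  exists U, V, 0, y; split => //.
  - by move=> i; rewrite mxE.
  - by move=> i j _; rewrite !mxE.
  rewrite X0 (_ : diagm 0 = 0) ?mulmx0 ?mul0mx//.
  by apply/matrixP => i j; rewrite !mxE if_same.
pose Z : 'M[R]_(1 + m, 1 + n) := P^T *m Y *m Q.
have YE : Y = P *m Z *m Q^T.
  by rewrite /Z !mulmxA orthogonalmxVr// mul1mx -mulmxA orthogonalmxVr// mulmx1.
pose D : 'M[R]_(1 + m, 1 + n) := block_mx s%:M 0 0 X'.
have DE : D = P^T *m X *m Q.
  by rewrite XE !mulmxA PO mul1mx -mulmxA QO mulmx1.
have DZ : D^T *m Z = 0.
  rewrite DE /Z !trmx_mul trmxK !mulmxA -(mulmxA _ P) orthogonalmxVr// mulmx1.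
  by rewrite -(mulmxA Q^T) XY mulmx0 mul0mx.
have ZD : D *m Z^T = 0.
  rewrite DE /Z !trmx_mul trmxK !mulmxA -(mulmxA _ Q) orthogonalmxVr// mulmx1.
  by rewrite -(mulmxA P^T) YX mulmx0 mul0mx.
move: DZ; rewrite /D -{1}(submxK Z) tr_block_mx mulmx_block !trmx0 !mul0mx.
rewrite !addr0 !add0r tr_scalar_mx !mul_scalar_mx -[RHS]submxK.
move=> /eq_block_mx[Zul Zur _ X'Z].
move: ZD; rewrite /D -{1}(submxK Z) tr_block_mx mulmx_block !mul0mx.
rewrite !addr0 !add0r !mul_scalar_mx -[RHS]submxK.
move=> /eq_block_mx[_ Zdl _ ZX'].
have scale0 k l (A : 'M[R]_(k, l)) : s *: A = 0 -> A = 0.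
  by move=> /eqP; rewrite scaler_eq0 (negbTE s_neq0) => /eqP.
have Zul0 : ulsubmx Z = 0%:M.
  by rewrite (scale0 _ _ (ulsubmx Z))// ?Zul; apply/matrixP => i j; rewrite !mxE ?mul0rn.
have Zur0 : ursubmx Z = 0.
  by apply: scale0; rewrite Zur; apply/matrixP => i j; rewrite !mxE.
have Zdl0 : dlsubmx Z = 0.
  rewrite -[LHS]trmxK (scale0 _ _ (dlsubmx Z)^T) ?trmx0// Zdl.
  by apply/matrixP => i j; rewrite !mxE.
have X'Z0 : X'^T *m drsubmx Z = 0.
  by rewrite X'Z; apply/matrixP => i j; rewrite !mxE.
have ZX'0 : X' *m (drsubmx Z)^T = 0.
  by rewrite ZX'; apply/matrixP => i j; rewrite !mxE.
have [U [V [x [y [[UO VO] x0 xn X'E Z'E]]]]] := IHn m X' (drsubmx Z) nm X'Z0 ZX'0.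
pose U' : 'M[R]_(1 + m) := block_mx 1%:M 0 0 U.
pose V' : 'M[R]_(1 + n) := block_mx 1%:M 0 0 V.
exists (P *m U'), (Q *m V'), (col_mx s%:M x : 'cV[R]_(1 + n)),
  (col_mx 0%:M y : 'cV[R]_(1 + n)); split.
- by split; (apply: orthogonalmxM => //; exact: orthogonalmx_block).
- by move=> i; rewrite !mxE; case: splitP => j _ //; rewrite mxE ord1.
- apply: nonincreasing_cV_col_mx => //; apply: (@svd_bound m n U V x s nm UO VO s0).
  by rewrite -X'E.
- by rewrite XE X'E diagm_border trmx_mul !mulmxA.
rewrite YE -(submxK Z) Zul0 Zur0 Zdl0 Z'E diagm_border trmx_mul.
by rewrite !mulmxA.
Qed.

End SingularValueDecomposition.

(** * Singular values read off a decomposition *)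

Section SingularValues.
Context {R : realType}.

Lemma char_poly_orthogonal n (V : 'M[R]_n) (A : 'M[R]_n) : orthogonalmx V ->
  char_poly (V *m A *m V^T) = char_poly A.
Proof.
move=> /orthogonalmxVr VV; rewrite /char_poly /char_poly_mx.
pose W := map_mx (@polyC R) V.
have WW : W *m W^T = 1%:M by rewrite /W map_trmx -map_mxM VV map_mx1.
have -> : 'X%:M - map_mx polyC (V *m A *m V^T) =
          W *m ('X%:M - map_mx polyC A) *m W^T.
  rewrite mulmxBr mulmxBl scalar_mxC -(mulmxA _ W W^T) WW mulmx1.
  by rewrite !map_mxM map_trmx.
by rewrite !det_mulmx mulrAC -det_mulmx WW det1 mul1r.
Qed.

Lemma char_poly_diag n (d : 'rV[R]_n) :
  char_poly (diag_mx d) = \prod_(a <- codom (d 0)) ('X - a%:P).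
Proof.
rewrite char_poly_trig ?diag_mx_is_trig// big_image /=.
by apply: eq_bigr => i _; rewrite mxE eqxx.
Qed.

Lemma mup_prod_XsubC (a : R) (s : seq R) :
  mup a (\prod_(b <- s) ('X - b%:P)) = count_mem a s.
Proof.
elim: s => [|b s IHs]; first by rewrite big_nil mupNroot// /root hornerC oner_eq0.
rewrite big_cons mupM ?polyXsubC_eq0//; last first.
  by rewrite monic_neq0// monic_prod_XsubC.
by rewrite IHs /= -['X - _]expr1 mup_XsubCX eq_sym; case: (b == a).
Qed.

Lemma perm_roots_with_mult (s : seq R) (p := \prod_(b <- s) ('X - b%:P)) :
  perm_eq (flatten [seq nseq (mup a p) a | a <- rootsR p]) s.
Proof.
have p0 : p != 0 by rewrite monic_neq0// monic_prod_XsubC.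
have rootsE a : (a \in rootsR p) = (a \in s).
  by rewrite -(root_prod_XsubC s a) -(roots_on_rootsR p0) in_itv.
have rU : uniq (rootsR p) by exact: uniq_roots.
apply/allP => a _ /=; apply/eqP; rewrite count_flatten -map_comp.
under eq_map => b do rewrite /= count_nseq mup_prod_XsubC.
rewrite sumnE big_map.
have [ain|aout] := boolP (a \in s).
  rewrite (bigD1_seq a) ?rootsE//= eqxx mul1n big1 ?addn0//.
  by move=> b /negbTE ba; rewrite ba mul0n.
rewrite big1_seq => [|b /=]; first by rewrite (count_memPn aout).
rewrite rootsE => bs; have /negbTE -> // : b != a.
by apply: contraNneq aout => <-.
Qed.

Section GivenSVD.
Context {m n : nat} (nm : (n <= m)%N) (U : 'M[R]_m) (V : 'M[R]_n) (x : 'cV[R]_n).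
Hypotheses (UO : orthogonalmx U) (VO : orthogonalmx V) (x_ge0 : forall i, 0 <= x i 0).

Let sq := codom (fun i => x i 0 ^+ 2).

Lemma tr_diagm_mul (y : 'cV[R]_n) :
  (diagm x : 'M[R]_(m, n))^T *m diagm y = diag_mx (\row_i (x i 0 * y i 0)).
Proof.
apply/matrixP => i j; rewrite !mxE (bigD1 (widen_ord nm i))//= !mxE /= eqxx.
rewrite big1 => [|k ki]; last first.
  rewrite !mxE; case: eqP => [ki'|]; last by rewrite mul0r.
  by case/eqP: ki; apply: val_inj.
rewrite addr0; case: (eqVneq i j) => [->|]; first by rewrite eqxx mulr1n.
by rewrite -val_eqE => /negbTE /= ->; rewrite mulr0n mulr0.
Qed.

Lemma perm_gram_eigenvalues :
  perm_eq (gram_eigenvalues (U *m diagm x *m V^T)) sq.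
Proof.
rewrite /gram_eigenvalues !trmx_mul trmxK !mulmxA -(mulmxA _ U^T) UO mulmx1.
rewrite -(mulmxA V) tr_diagm_mul char_poly_orthogonal// char_poly_diag.
rewrite (_ : codom _ = sq); first exact: perm_roots_with_mult.
by rewrite /sq; apply: eq_codom => i; rewrite mxE expr2.
Qed.

(** Phi only sees the multiset of singular values, so the diagonal of the
    decomposition need not be sorted; this is what makes Phi computable after
    one diagonal entry has been moved. *)
Lemma Phi_svd nu : Phi nu (U *m diagm x *m V^T) = \sum_i phi nu (x i 0).
Proof.
pose s := sort >=%R (gram_eigenvalues (U *m diagm x *m V^T)).
have sP : perm_eq s sq by rewrite perm_sort perm_gram_eigenvalues.
have size_s : size s = n by rewrite (perm_size sP) size_codom card_ord.
transitivity (\sum_(a <- s) phi nu (Num.sqrt a)).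
  rewrite (big_nth 0) size_s big_mkord.
  by apply: eq_bigr => i _; rewrite mxE.
rewrite (perm_big _ sP) /= big_image /=; apply: eq_bigr => i _.
by rewrite sqrtr_sqr ger0_norm.
Qed.

Lemma singval_svd : nonincreasing_cV x -> singval (U *m diagm x *m V^T) = x.
Proof.
move=> xn; apply/colP => i; rewrite mxE.
have -> : sort >=%R (gram_eigenvalues (U *m diagm x *m V^T)) = sq.
  rewrite -[RHS](@sorted_sort _ (>=%R : rel R)).
  - by apply/perm_sortP; [exact: ge_total | exact: ge_trans | exact: ge_anti
      | exact: perm_gram_eigenvalues].
  - exact: ge_trans.
  apply/(sortedP 0) => k; rewrite size_codom card_ord => kn.
  have xE j (jn : (j < n)%N) : sq`_j = x (Ordinal jn) 0 ^+ 2.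
    rewrite /sq codomE (nth_map (Ordinal jn)) ?size_enum_ord//.
    by congr (x _ 0 ^+ 2); apply: val_inj; rewrite /= nth_enum_ord.
  have kn' := ltnW kn; rewrite (xE _ kn) (xE _ kn') /=.
  by rewrite ler_sqr ?nnegrE//; apply: xn => /=.
rewrite /sq codomE (nth_map i) ?size_enum_ord// nth_ord_enum.
by rewrite sqrtr_sqr ger0_norm.
Qed.

End GivenSVD.

Lemma rank_diag_mx n (d : 'rV[R]_n) :
  \rank (diag_mx d) = (\sum_i (d 0 i != 0)%R)%N.
Proof.
elim: n d => [|n IHn] d; first by rewrite big_ord0 flatmx0 mxrank0.
pose d' : 'rV[R]_(1 + n) := d.
have -> : \rank (diag_mx d) = \rank (diag_mx (row_mx (lsubmx d') (rsubmx d'))).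
  by rewrite hsubmxK.
rewrite big_ord_recl diag_mx_row rank_diag_block_mx IHn; congr (_ + _)%N.
  rewrite (_ : diag_mx _ = (d 0 ord0)%:M) ?rank_rV; last first.
    by apply/matrixP => i j; rewrite !mxE !ord1 lshift0.
  by rewrite -sqnorm_eq0 sqnorm_scalar sqrf_eq0.
apply: eq_bigr => i _; rewrite mxE.
by rewrite (_ : rshift 1 i = lift ord0 i)//; apply: val_inj.
Qed.

(** The rectangular diagonal matrix factors through the square one, on the left by
    the matrix with unit diagonal, which has full column rank. *)
Lemma rank_diagm m n (x : 'cV[R]_n) : (n <= m)%N ->
  \rank (diagm x : 'M[R]_(m, n)) = (\sum_i (x i 0 != 0)%R)%N.
Proof.
move=> nm; pose J : 'M[R]_(m, n) := diagm (const_mx 1).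
have -> : diagm x = J *m diag_mx x^T.
  apply/matrixP => i j; rewrite mul_mx_diag !mxE.
  by case: ifP; rewrite ?mul1r ?mul0r.
have fJ : row_full J.
  apply/row_fullP; exists J^T; rewrite tr_diagm_mul// -diag_const_mx.
  by congr diag_mx; apply/rowP => i; rewrite !mxE mulr1.
rewrite (eqmxMfull _ fJ) rank_diag_mx.
by apply: eq_bigr => i _; rewrite mxE.
Qed.

Lemma rank_orthogonal_equiv m n (U : 'M[R]_m) (V : 'M[R]_n) (A : 'M[R]_(m, n)) :
  orthogonalmx U -> orthogonalmx V -> \rank (U *m A *m V^T) = \rank A.
Proof.
have rank_le k l P Q (B : 'M[R]_(k, l)) : (\rank (P *m B *m Q) <= \rank B)%N.
  exact: leq_trans (mxrankM_maxl _ _) (mxrankM_maxr _ _).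
move=> UO VO; apply/eqP; rewrite eqn_leq rank_le /=.
have {1}-> : A = U^T *m (U *m A *m V^T) *m V.
  by rewrite !mulmxA UO mul1mx -mulmxA VO mulmx1.
exact: rank_le.
Qed.

Lemma Phi_le_rank m n nu (X : 'M[R]_(m, n)) : (n <= m)%N -> 0 < nu ->
  Phi nu X <= (\rank X)%:R.
Proof.
move=> nm nu0; have [U [V [x [UO VO x0 _ ->]]]] := svd_exists X nm.
rewrite Phi_svd// rank_orthogonal_equiv// rank_diagm// natr_sum.
apply: ler_sum => i _; rewrite /phi; case: eqVneq => [->|_] /=.
  by rewrite mul0r ge_min lexx orbT.
by rewrite ge_min lexx.
Qed.

End SingularValues.

(** * Frobenius inner product *)

Section FrobeniusInner.
Context {R : realType} {m n : nat}.
Implicit Types X Y Z : 'M[R]_(m, n).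

Lemma frob_innerE X Y : frob_inner X Y = \sum_i \sum_j X i j * Y i j.
Proof.
rewrite /frob_inner /mxtrace; apply: eq_bigr => i _.
by rewrite mxE; apply: eq_bigr => j _; rewrite mxE.
Qed.

Lemma frob_innerDl X Y Z : frob_inner (X + Y) Z = frob_inner X Z + frob_inner Y Z.
Proof. by rewrite /frob_inner mulmxDl raddfD. Qed.

Lemma frob_innerDr X Y Z : frob_inner X (Y + Z) = frob_inner X Y + frob_inner X Z.
Proof. by rewrite /frob_inner linearD mulmxDr raddfD. Qed.

Lemma frob_innerZl a X Y : frob_inner (a *: X) Y = a * frob_inner X Y.
Proof. by rewrite /frob_inner -scalemxAl mxtraceZ. Qed.

Lemma frob_innerZr a X Y : frob_inner X (a *: Y) = a * frob_inner X Y.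
Proof. by rewrite /frob_inner linearZ -scalemxAr mxtraceZ. Qed.

Lemma frob_inner_delta i j Y : frob_inner (delta_mx i j) Y = Y i j.
Proof.
rewrite frob_innerE (bigD1 i)//= (bigD1 j)//= !mxE !eqxx mul1r.
rewrite big1 ?addr0 => [|k /negbTE kj]; last by rewrite mxE kj andbF mul0r.
rewrite big1 ?addr0// => k /negbTE ki; rewrite big1// => l _.
by rewrite mxE ki mul0r.
Qed.

Lemma frob_norm_scale a X : frob_norm (a *: X) = `|a| * frob_norm X.
Proof.
rewrite /frob_norm frob_innerZl frob_innerZr mulrA -expr2 sqrtrM ?sqr_ge0//.
by rewrite sqrtr_sqr.
Qed.

Lemma frob_inner_equiv (U : 'M[R]_m) (V : 'M[R]_n) X Y :
  frob_inner (U *m X *m V^T) Y = frob_inner X (U^T *m Y *m V).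
Proof.
rewrite /frob_inner !trmx_mul trmxK -!mulmxA mxtrace_mulC.
by rewrite !mulmxA.
Qed.

Lemma frob_norm_orthogonal (U : 'M[R]_m) (V : 'M[R]_n) X :
  orthogonalmx U -> orthogonalmx V -> frob_norm (U *m X *m V^T) = frob_norm X.
Proof.
move=> UO VO; rewrite /frob_norm frob_inner_equiv !mulmxA UO mul1mx.
by rewrite -mulmxA VO mulmx1.
Qed.

Lemma diagmD (x y : 'cV[R]_n) : diagm (x + y) = diagm x + diagm y :> 'M[R]_(m, n).
Proof. by apply/matrixP => i j; rewrite !mxE; case: ifP; rewrite ?addr0. Qed.

Lemma diagmZ (a : R) (x : 'cV[R]_n) : diagm (a *: x) = a *: diagm x :> 'M[R]_(m, n).
Proof. by apply/matrixP => i j; rewrite !mxE; case: ifP; rewrite ?mulr0. Qed.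

Lemma frob_inner_diagm (nm : (n <= m)%N) (x y : 'cV[R]_n) :
  frob_inner (diagm x : 'M[R]_(m, n)) (diagm y) = \sum_i x i 0 * y i 0.
Proof.
rewrite /frob_inner mxtrace_mulC -[X in \tr X]trmxK mxtrace_tr trmx_mul trmxK.
rewrite tr_diagm_mul// mxtrace_diag.
by apply: eq_bigr => i _; rewrite mxE.
Qed.

Lemma frob_norm_Ediag (nm : (n <= m)%N) i : frob_norm (Ediag i : 'M[R]_(m, n)) = 1.
Proof.
rewrite /frob_norm /Ediag frob_inner_diagm// (bigD1 i)//= big1 ?addr0.
  by rewrite !mxE !eqxx mulr1 sqrtr1.
by move=> j /negbTE ji; rewrite !mxE ji mul0r.
Qed.

End FrobeniusInner.

(** * Subgradients of convex functions *)

Section ConvexFunctions.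
Context {R : realType}.

Lemma convex_functionE (E : lmodType R) (f : E -> R) :
  convex_function (E := E) setT f -> forall t x y, 0 <= t <= 1 ->
  f (t *: x + (1 - t) *: y) <= t * f x + (1 - t) * f y.
Proof.
move=> fc t x y t01.
have t01' : Itv.spec (@Itv.num_sem R) (Itv.Real `[0%Z, 1%Z]) t.
  by rewrite /Itv.spec /= /Itv.num_sem /= num_real in_itv /=; rewrite t01.
by have := fc (Itv.mk t01') x y; rewrite !inE => /(_ I I).
Qed.

(** One step of the Hahn-Banach extension, for a convex k.  The convex
    combination of x - b e and y + a e that cancels e lies in T, where k is
    nonnegative; hence every backward slope - k (x - b e) / b is at most every
    forward slope k (y + a e) / a, and the supremum of the backward slopes
    separates them. *)
Lemma convex_slope_exists (E : lmodType R) (k : E -> R) (T : set E) (e : E) :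
  (forall t x y, 0 <= t <= 1 -> k (t *: x + (1 - t) *: y) <= t * k x + (1 - t) * k y) ->
  T 0 -> (forall t x y, 0 <= t <= 1 -> T x -> T y -> T (t *: x + (1 - t) *: y)) ->
  (forall x, T x -> 0 <= k x) ->
  exists c, forall x h, T x -> c * h <= k (x + h *: e).
Proof.
move=> kc T0 Tc k0.
have cross a b x y : 0 < a -> 0 < b -> T x -> T y ->
    - k (x - b *: e) / b <= k (y + a *: e) / a.
  move=> a0 b0 Tx Ty; have ab0 : 0 < a + b by rewrite addr_gt0.
  pose t := a / (a + b).
  have t01 : 0 <= t <= 1.
    by rewrite /t ler_pdivrMr// mul1r lerDl (ltW b0) andbT divr_ge0// ltW.
  have tE : 1 - t = b / (a + b) by rewrite /t; field; rewrite gt_eqF.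
  have := kc t (x - b *: e) (y + a *: e) t01.
  have -> : t *: (x - b *: e) + (1 - t) *: (y + a *: e) = t *: x + (1 - t) *: y.
    rewrite !scalerDr scalerN !scalerA addrACA tE /t.
    by rewrite [b / _ * a]mulrAC [a / _ * b]mulrAC [b * a]mulrC addNr addr0.
  have := k0 _ (Tc _ _ _ t01 Tx Ty).
  move=> /le_trans h /h; rewrite tE /t.
  have -> : a / (a + b) * k (x - b *: e) + b / (a + b) * k (y + a *: e) =
     (a * b / (a + b)) * (k (y + a *: e) / a - (- k (x - b *: e) / b)).
    by field; rewrite !gt_eqF.
  by rewrite pmulr_rge0 ?subr_ge0// divr_gt0// mulr_gt0.
pose A := [set - k (x.1 - x.2 *: e) / x.2 | x in [set x : E * R | T x.1 /\ 0 < x.2]].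
have A0 : A !=set0 by exists (- k (0 - 1 *: e) / 1); exists (0, 1).
have Aub y a : T y -> 0 < a -> ubound A (k (y + a *: e) / a).
  by move=> Ty a0 _ [[x b] /= [Tx b0] <-]; exact: cross.
have supA : has_sup A by split => //; exists (k (0 + 1 *: e) / 1); exact: Aub.
exists (sup A) => x h Tx; have [h0|h0|->] := ltgtP h 0.
- have : - k (x - (- h) *: e) / (- h) <= sup A.
    by apply: ub_le_sup; [case: supA | exists (x, - h) => //=; rewrite oppr_gt0].
  rewrite scaleNr opprK invrN mulrNN => hle.
  by rewrite -ler_ndivrMr.
- by rewrite -ler_pdivlMr//; apply: ge_sup => //; exact: Aub.
- by rewrite mulr0 scale0r addr0 k0.
Qed.

End ConvexFunctions.

Section SubgradientExistence.
Context {R : realType} {m n : nat}.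

(** If X minimises f along the matrices supported in S, the zero functional
    supports f there; it is extended to one matrix entry outside S after the
    other.  Extending along entries keeps the values on S untouched, which is
    why the resulting subgradient vanishes on S. *)
Lemma subgradient_vanishing_on (f : 'M[R]_(m, n) -> R) (X : 'M[R]_(m, n))
    (S : pred ('I_m * 'I_n)) :
  convex_function (E := 'M[R]_(m, n)) setT f ->
  (forall H : 'M[R]_(m, n), (forall i j, ~~ S (i, j) -> H i j = 0) -> f X <= f (X + H)) ->
  exists2 G, subdiff f X G & forall i j, S (i, j) -> G i j = 0.
Proof.
move=> fc fmin.
pose supp (s : seq ('I_m * 'I_n)) : set 'M[R]_(m, n) :=
  [set H | forall i j, ~~ S (i, j) -> (i, j) \notin s -> H i j = 0].
have ext s : exists2 G : 'M[R]_(m, n),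
    forall H, supp s H -> f X + frob_inner G H <= f (X + H) &
    forall i j, S (i, j) -> G i j = 0.
  elim: s => [|[i j] s [G Gsub G0]].
    exists 0 => [H HS|i j _]; last by rewrite mxE.
    rewrite (_ : frob_inner 0 H = 0) ?addr0; last by rewrite /frob_inner mul0mx mxtrace0.
    by apply: fmin => i j /HS; exact.
  have [Sij|NSij] := boolP (S (i, j)).
    exists G => // H HS; apply: Gsub => i' j' NS' s'; apply: HS => //.
    rewrite in_cons negb_or s' andbT; apply: contraNneq NS' => ->; exact: Sij.
  pose k H := f (X + H) - f X - frob_inner G H.
  have kc t H K : 0 <= t <= 1 ->
      k (t *: H + (1 - t) *: K) <= t * k H + (1 - t) * k K.
    move=> t01; rewrite /k frob_innerDr !frob_innerZr.
    have := convex_functionE fc (X + H) (X + K) t01.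
    rewrite !scalerDr addrACA -scalerDl [t + _]addrC subrK scale1r.
    set a := f _; set b := f _; set c := f _; set d := f X.
    move: (frob_inner _ _) (frob_inner _ _) => p q h.
    rewrite -subr_ge0 in h; rewrite -subr_ge0.
    by congr (_ <= _): h; ring.
  have [|t H K t01 HS KS|H HS|c cP] := @convex_slope_exists _ _ k (supp s) (delta_mx i j) kc.
  - by move=> i' j' _ _; rewrite mxE.
  - by move=> i' j' N1 N2; rewrite !mxE (HS _ _ N1 N2) (KS _ _ N1 N2) !mulr0 addr0.
  - by rewrite /k -addrA -opprD subr_ge0 Gsub.
  exists (G + c *: delta_mx i j) => [H HS|i' j' S'].
    pose H0 := H - H i j *: delta_mx i j.
    have H0s : supp s H0.
      move=> i' j' N1 N2; rewrite /H0 !mxE -xpair_eqE.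
      have [[-> ->]|ne] := eqVneq (i', j') (i, j); first by rewrite mulr1 subrr.
      by rewrite mulr0 subr0 HS// in_cons negb_or ne.
    have := cP H0 (H i j) H0s; rewrite subrK /k -addrA -opprD lerBrDr.
    by rewrite frob_innerDl frob_innerZl frob_inner_delta addrC addrA.
  rewrite !mxE G0// -xpair_eqE add0r.
  have /negbTE -> : (i', j') != (i, j) by apply: contraNneq NSij => <-.
  by rewrite mulr0.
have [G Gsub G0] := ext (enum (predT : pred ('I_m * 'I_n))).
exists G => // Y; rewrite -[in leRHS](subrKC X Y); apply: Gsub => i j _.
by rewrite mem_enum.
Qed.


End SubgradientExistence.

(** * First-order consequences of local minimality *)

Section FirstOrder.
Context {R : realType} {m n : nat}.
Implicit Types (f : 'M[R]_(m, n) -> R) (X A B : 'M[R]_(m, n)).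

Lemma near_quadratic_curve X A B (P : 'M[R]_(m, n) -> Prop) :
  (\forall Y \near X, P Y) ->
  \forall t \near 0^'+, P (X + t *: A + t ^+ 2 *: B).
Proof.
have cv : (fun t : R => X + t *: A + t ^+ 2 *: B) @ 0^'+ --> X.
  apply: cvg_within_filter.
  have {2}-> : X = X + 0 *: A + 0 ^+ 2 *: B.
    by rewrite expr0n !scale0r !addr0.
  apply: cvgD; first apply: cvgD; first exact: cvg_cst.
    by apply: cvgZr_tmp; exact: cvg_id.
  by apply: cvgZr_tmp; exact: exprn_continuous.
by move=> XP; exact: cv XP.
Qed.

Lemma phi_ge (nu t : R) : 0 < nu -> nu <= t -> phi nu t = 1.
Proof.
move=> nu0 nut; rewrite /phi; apply/min_idPl.
by rewrite ler_pdivlMr// mul1r.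
Qed.

Lemma phi_le (nu t : R) : 0 < nu -> t <= nu -> phi nu t = t / nu.
Proof.
by move=> nu0 nut; rewrite /phi; apply/min_idPr; rewrite ler_pdivrMr// mul1r.
Qed.

(** Below the threshold nu, the penalty has slope lambda / nu > L, so that lowering
    a positive singular value gains more than f can lose. *)
Lemma singval_gap f (L lambda nu : R) X : (n <= m)%N -> 0 < lambda -> 0 < L -> 0 < nu ->
  nu < lambda / L -> frob_lipschitz L f ->
  (\forall Y \near X, f X + lambda * Phi nu X <= f Y + lambda * Phi nu Y) ->
  forall i, singval X i 0 = 0 \/ nu <= singval X i 0.
Proof.
move=> nm l0 L0 nu0 nuL fL Xmin i.
have [U [V [x [UO VO x0 xn XE]]]] := svd_exists X nm.
have -> : singval X = x by rewrite XE singval_svd.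
have [|xi_lt] := leP nu (x i 0); first by right.
have [->|xi0] := eqVneq (x i 0) 0; first by left.
have {xi0}xi_gt : 0 < x i 0 by rewrite lt_def xi0 x0.
have /filter_ex[t [t0 [txi tmin]]] : \forall t \near 0^'+, 0 < t /\ (t <= x i 0 /\
    f X + lambda * Phi nu X <= f (X + t *: - (U *m Ediag i *m V^T) + t ^+ 2 *: 0)
      + lambda * Phi nu (X + t *: - (U *m Ediag i *m V^T) + t ^+ 2 *: 0)).
  near=> t; split; [|split]; near: t.
  - exact: nbhs_right_gt.
  - exact: nbhs_right_le.
  - have := near_quadratic_curve (- (U *m Ediag i *m V^T)) 0 Xmin. by apply.
exfalso; move: tmin; rewrite scaler0 addr0.
set Y := X + _.
have YE : Y = U *m diagm (x - t *: delta_mx i 0) *m V^T.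
  rewrite /Y XE -scaleNr diagmD diagmZ mulmxDr mulmxDl.
  by rewrite scalerN -scalemxAr -scalemxAl scaleNr.
have PX : Phi nu X = \sum_j phi nu (x j 0) by rewrite XE Phi_svd.
have PY : Phi nu Y = \sum_j phi nu (x j 0) - t / nu.
  rewrite YE Phi_svd//; last first.
    move=> j; rewrite !mxE andbT; case: (eqVneq j i) => [->|_].
      by rewrite mulr1 subr_ge0.
    by rewrite mulr0 subr0.
  rewrite (bigD1 i)//= [in RHS](bigD1 i)//= addrAC; congr (_ + _).
    rewrite !mxE !eqxx mulr1 !phi_le//; first by rewrite mulrBl.
      exact: ltW.
    by rewrite lerBlDr (le_trans (ltW xi_lt))// lerDl ltW.
  by apply: eq_bigr => j /negbTE ji; rewrite !mxE ji mulr0 subr0.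
have fY : f Y - f X <= L * t.
  apply: le_trans (ler_norm _) (le_trans (fL _ _) _).
  rewrite /Y addrC addKr frob_norm_scale.
  rewrite -scaleN1r frob_norm_scale frob_norm_orthogonal// frob_norm_Ediag//.
  by rewrite normrN1 !mulr1 gtr0_norm.
rewrite PX PY mulrBr => h.
have : lambda * (t / nu) <= L * t.
  by move: h fY; lra.
rewrite mulrA ler_pdivrMr// mulrAC ler_pM2r//.
by rewrite leNgt mulrC -ltr_pdivlMr ?nuL.
Unshelve. all: by end_near. Qed.

(** The matrices Q X + X P form the tangent space at X of the matrices of rank at
    most rank X.  The curve (1 + t Q) X (1 + t P) stays among the latter, so
    Phi does not exceed Phi X on it, and it differs from the tangent line by
    t^2 Q X P, which costs O(t^2) in f; convexity along the line bounds the
    gain by t (f (X + H) - f X), and dividing by t concludes. *)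
Lemma local_min_on_tangent f (L lambda nu : R) X : (n <= m)%N ->
  0 < lambda -> 0 < nu ->
  convex_function (E := 'M[R]_(m, n)) setT f -> frob_lipschitz L f ->
  (\forall Y \near X, f X + lambda * Phi nu X <= f Y + lambda * Phi nu Y) ->
  Phi nu X = (\rank X)%:R ->
  forall (Q : 'M[R]_m) (P : 'M[R]_n), f X <= f (X + (Q *m X + X *m P)).
Proof.
move=> nm l0 nu0 fc fL Xmin PX Q P.
set H := _ + X *m P; pose C := Q *m X *m P.
have curve t : X + t *: H + t ^+ 2 *: C = (1%:M + t *: Q) *m X *m (1%:M + t *: P).
  rewrite [(1%:M + _) *m X]mulmxDl mul1mx -scalemxAl mulmxDr mulmx1 -scalemxAr.
  by rewrite mulmxDl -scalemxAl [in RHS]scalerDr scalerA -expr2 /H [in LHS]scalerDr !addrA.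
have key : \forall t \near 0^'+, f X <= f (X + H) + t * (L * frob_norm C).
  have := near_quadratic_curve H C Xmin.
  move=> near_min; near=> t.
  have t0 : 0 < t by near: t; exact: nbhs_right_gt.
  have t1 : t <= 1 by near: t; exact: nbhs_right_le.
  have : f X + lambda * Phi nu X <= f (X + t *: H + t ^+ 2 *: C)
      + lambda * Phi nu (X + t *: H + t ^+ 2 *: C) by near: t.
  have rankC : Phi nu (X + t *: H + t ^+ 2 *: C) <= Phi nu X.
    rewrite PX (le_trans (Phi_le_rank _ nm nu0))// ler_nat curve.
    exact: leq_trans (mxrankM_maxl _ _) (mxrankM_maxr _ _).
  have : f (X + t *: H + t ^+ 2 *: C) - f (X + t *: H) <= L * (t ^+ 2 * frob_norm C).
    apply: le_trans (ler_norm _) (le_trans (fL _ _) _).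
    by rewrite addrC addKr frob_norm_scale ger0_norm ?sqr_ge0.
  have : f (X + t *: H) <= t * f (X + H) + (1 - t) * f X.
    have := convex_functionE fc (X + H) X (t := t).
    rewrite (ltW t0) t1 => /(_ isT); congr (f _ <= _).
    by rewrite scalerDr scalerBl scale1r addrAC addrCA subrr addr0 addrC.
  have : lambda * Phi nu (X + t *: H + t ^+ 2 *: C) <= lambda * Phi nu X.
    by rewrite ler_pM2l.
  move: (f (X + t *: H + _)) (f (X + t *: H)) (Phi nu (X + t *: H + _)) (Phi nu X) (frob_norm C).
  move=> a b c d e h1 h2 h3 h4.
  have : 0 <= t * (f (X + H) + t * (L * e) - f X) by rewrite expr2 in h3; lra.
  by rewrite pmulr_rge0// subr_ge0.
apply/ler_addgt0Pl => e e0.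
have /filter_ex[t [tk te]] : \forall t \near 0^'+,
    f X <= f (X + H) + t * (L * frob_norm C) /\ t * (L * frob_norm C) <= e.
  near=> t; split; near: t; first exact: key.
  have : t * (L * frob_norm C) @[t --> 0^'+] --> 0 * (L * frob_norm C).
    by apply: cvgMl; apply: cvg_within_filter; exact: cvg_id.
  rewrite mul0r => /cvgr_le; exact.
by rewrite addrC (le_trans tk)// lerD2l.
Unshelve. all: by end_near. Qed.

End FirstOrder.

(** * Lifted stationarity *)

Section Stationarity.
Context {R : realType} {m n : nat}.
Implicit Types (f : 'M[R]_(m, n) -> R) (X : 'M[R]_(m, n)).

Lemma convex_function_equiv f (U : 'M[R]_m) (V : 'M[R]_n) :
  convex_function (E := 'M[R]_(m, n)) setT f ->
  convex_function (E := 'M[R]_(m, n)) setT (fun H => f (U *m H *m V^T)).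
Proof.
move=> fc t H K _ _.
have := fc t (U *m H *m V^T) (U *m K *m V^T); rewrite !inE => /(_ I I).
congr (f _ <= _).
by rewrite [in RHS]mulmxDr [in RHS]mulmxDl -!scalemxAr -!scalemxAl.
Qed.

Lemma subdiff_equiv f (U : 'M[R]_m) (V : 'M[R]_n) (D G : 'M[R]_(m, n)) :
  orthogonalmx U -> orthogonalmx V ->
  subdiff (fun H => f (U *m H *m V^T)) D G ->
  subdiff f (U *m D *m V^T) (U *m G *m V^T).
Proof.
move=> UO VO Gsub Y; have := Gsub (U^T *m Y *m V).
have -> : U *m (U^T *m Y *m V) *m V^T = Y.
  by rewrite !mulmxA orthogonalmxVr// mul1mx -mulmxA orthogonalmxVr// mulmx1.
congr (_ + _ <= _); rewrite frob_inner_equiv; congr frob_inner.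
rewrite mulmxBr mulmxBl; congr (_ - _).
by rewrite !mulmxA UO mul1mx -mulmxA VO mulmx1.
Qed.

(** In the bases of an SVD, X becomes a diagonal D and its tangent space
    consists of the matrices supported on the rows and columns where D is nonzero:
    with D' the pseudo-inverse of D, J = D D'^T and K = D'^T D the
    projections onto these rows and columns, such an H equals
    J H + (1 - J) H K = D (D'^T H) + ((1 - J) H D'^T) D.  A subgradient vanishing on
    this support is annihilated by D on both sides. *)
Lemma subgradient_normal_to_tangent f X : (n <= m)%N ->
  convex_function (E := 'M[R]_(m, n)) setT f ->
  (forall (Q : 'M[R]_m) (P : 'M[R]_n), f X <= f (X + (Q *m X + X *m P))) ->
  exists G, [/\ subdiff f X G, X^T *m G = 0 & X *m G^T = 0].
Proof.
move=> nm fc fmin.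
have [U [V [x [UO VO _ _ XE]]]] := svd_exists X nm.
pose D : 'M[R]_(m, n) := diagm x; rewrite -/D in XE.
pose D' : 'M[R]_(m, n) := diagm (\col_i (x i 0)^-1).
pose J := D *m D'^T; pose K := D'^T *m D.
have JE i j : i != j -> J i j = 0.
  move=> ij; rewrite mxE big1// => k _; rewrite !mxE.
  case: eqP => [ik|_]; last by rewrite mul0r.
  case: eqP => [jk|_]; last by rewrite mulr0.
  by case/eqP: ij; apply: val_inj; rewrite /= ik jk.
have JD i j : D i j != 0 -> J i i = 1.
  rewrite mxE; case: (nat_of_ord i =P j) => [ij|_]; last by rewrite eqxx.
  move=> xj; rewrite mxE (bigD1 j)//= !mxE ij eqxx mulfV// big1 ?addr0// => k kj.
  rewrite !mxE ifF ?mul0r//; apply/negbTE; apply: contraNneq kj => jk.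
  by apply/eqP/val_inj; rewrite /= -jk ij.
have KE : K = diag_mx (\row_i ((x i 0)^-1 * x i 0)).
  by rewrite /K tr_diagm_mul//; congr diag_mx; apply/rowP => i; rewrite !mxE.
have KD i j : D i j != 0 -> K j j = 1.
  rewrite mxE; case: (nat_of_ord i =P j) => [ij xj|_]; last by rewrite eqxx.
  by rewrite KE !mxE eqxx mulVf.
pose S (p : 'I_m * 'I_n) := (J p.1 p.1 == 1) || (K p.2 p.2 == 1).
have supp_tangent (H : 'M[R]_(m, n)) : (forall i j, ~~ S (i, j) -> H i j = 0) ->
    H = J *m H + (1%:M - J) *m H *m K.
  move=> HS.
  have JHE (A : 'M[R]_(m, n)) i j : (J *m A) i j = J i i * A i j.
    rewrite mxE (bigD1 i)//= big1 ?addr0// => k ki.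
    by rewrite JE ?mul0r// eq_sym.
  apply/matrixP => i j.
  rewrite KE mul_mx_diag mulmxBl mul1mx.
  rewrite [RHS]mxE JHE [in X in _ + X]mxE [in X in _ + X]mxE [in X in _ + X]mxE JHE.
  have Kjj : K j j = (\row_i ((x i 0)^-1 * x i 0)) 0 j by rewrite KE [LHS]mxE eqxx mulr1n.
  rewrite -Kjj; have [|/HS ->] := boolP (S (i, j)); last by rewrite !(mulr0, subrr, mul0r, addr0).
  by rewrite /S /= => /orP[] /eqP ->; ring.
have [|G Gsub GS] := @subgradient_vanishing_on _ _ _ _ D S (@convex_function_equiv f U V fc).
  move=> H HS; rewrite [in leRHS](supp_tangent _ HS) -XE.
  have := fmin (U *m (1%:M - J) *m H *m D'^T *m U^T) (V *m D'^T *m H *m V^T).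
  congr (_ <= f _).
  rewrite [in RHS]mulmxDr [in RHS]mulmxDl -XE; congr (_ + _).
  rewrite [in RHS]mulmxDr [in RHS]mulmxDl [RHS]addrC; congr (_ + _).
    by rewrite XE /K !mulmxA -(mulmxA _ U^T) UO mulmx1.
  by rewrite XE /J !mulmxA -(mulmxA _ V^T) VO mulmx1.
have DG : D^T *m G = 0.
  apply/matrixP => i j; rewrite !mxE big1// => k _; rewrite [D^T _ _]mxE.
  have [->|Dki] := eqVneq (D k i) 0; first by rewrite mul0r.
  by rewrite GS ?mulr0// /S /= (JD _ _ Dki) eqxx.
have GD : D *m G^T = 0.
  apply/matrixP => i j; rewrite !mxE big1// => k _; rewrite [G^T _ _]mxE.
  have [->|Dik] := eqVneq (D i k) 0; first by rewrite mul0r.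
  by rewrite GS ?mulr0// /S /= (KD _ _ Dik) eqxx orbT.
exists (U *m G *m V^T); rewrite XE; split.
- exact: subdiff_equiv.
- rewrite !trmx_mul trmxK !mulmxA -(mulmxA _ U^T) UO mulmx1.
  by rewrite -(mulmxA V) DG mulmx0 mul0mx.
- rewrite !trmx_mul trmxK !mulmxA -(mulmxA _ V^T) VO mulmx1.
  by rewrite -(mulmxA U) GD mulmx0 mul0mx.
Qed.

(** Test the subgradient inequality in the directions U E_i V^T and - U E_i V^T,
    which have Frobenius norm 1. *)
Lemma subdiff_lipschitz_bound f L X (U : 'M[R]_m) (V : 'M[R]_n) (y : 'cV[R]_n) :
  (n <= m)%N -> orthogonalmx U -> orthogonalmx V -> frob_lipschitz L f ->
  subdiff f X (U *m diagm y *m V^T) -> forall i, `|y i 0| <= L.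
Proof.
move=> nm UO VO fL Gsub i.
have bnd (a : R) : `|a| = 1 -> a * y i 0 <= L.
  move=> a1; have := Gsub (X + a *: (U *m Ediag i *m V^T)).
  rewrite addrAC subrr add0r frob_innerZr frob_inner_equiv.
  have -> : U^T *m (U *m Ediag i *m V^T) *m V = Ediag i.
    by rewrite !mulmxA UO mul1mx -mulmxA VO mulmx1.
  rewrite frob_inner_diagm// (bigD1 i)//= big1 => [|j /negbTE ji]; last first.
    by rewrite mxE ji mulr0.
  rewrite !mxE !eqxx mulr1 addr0 -lerBrDl => /le_trans; apply.
  apply: le_trans (ler_norm _) (le_trans (fL _ _) _).
  rewrite addrAC subrr add0r frob_norm_scale a1 frob_norm_orthogonal//.
  by rewrite frob_norm_Ediag// !mulr1.
rewrite ler_norml; have := bnd 1; have := bnd (-1).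
rewrite normrN1 normr1 => /(_ erefl) h1 /(_ erefl) h2.
by apply/andP; split; lra.
Qed.

Lemma subdiff_l1norm (x s : 'cV[R]_n) : (forall i, 0 <= x i 0) ->
  (forall i, `|s i 0| <= 1) -> (forall i, x i 0 != 0 -> s i 0 = 1) ->
  subdiff l1norm x s.
Proof.
move=> x0 s1 sx y; rewrite frob_innerE /l1norm -big_split /=.
apply: ler_sum => i _; rewrite big_ord1 !mxE ger0_norm//.
have sy : s i 0 * y i 0 <= `|y i 0|.
  by rewrite (le_trans (ler_norm _))// normrM ler_piMl.
have [xi0|xi0] := eqVneq (x i 0) 0.
  by rewrite xi0 subr0 add0r.
by move: sy; rewrite (sx _ xi0); lra.
Qed.

End Stationarity.

Lemma derive1_theta (R : realType) (nu : R) (k : 'I_2) (t : R) :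
  derive1 (theta nu k) t = if k == 0 then 0 else nu^-1.
Proof.
rewrite /theta derive1E; case: (k == 0); first exact: derive_cst.
have dt : is_derive t 1 (fun u : R => u / nu - 1) (nu^-1).
  by apply: is_derive_eq; rewrite subr0 scaler0 add0r [LHS]mulr1.
by case: dt.
Qed.

Theorem theorem2p3 (R : realType) (m n : nat) (hn : (0 < n)%N) (hnm : (n <= m)%N)
    (lambda L nu : R) (hlambda : 0 < lambda) (hL : 0 < L)
    (hnu : 0 < nu) (hnu_bar : nu < lambda / L)
    (f : 'M[R]_(m, n) -> R) (hf_ge0 : forall X, 0 <= f X)
    (hf_convex : convex_function (E := 'M[R]_(m, n)) setT f)
    (hf_lipschitz : frob_lipschitz L f)
    (Xbar : 'M[R]_(m, n))
    (hmin : \forall X \near Xbar,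
      f Xbar + lambda * Phi nu Xbar <= f X + lambda * Phi nu X) :
  lifted_stationary nu lambda f Xbar.
Proof.
have gap := singval_gap hnm hlambda hL hnu hnu_bar hf_lipschitz hmin.
have Phi_rank : Phi nu Xbar = (\rank Xbar)%:R.
  have [U [V [x [UO VO x0 xn XE]]]] := svd_exists Xbar hnm.
  have xE : singval Xbar = x by rewrite XE singval_svd.
  rewrite /Phi {2}XE rank_orthogonal_equiv// rank_diagm// natr_sum.
  apply: eq_bigr => i _; rewrite -xE.
  have [->|xi] := gap i; first by rewrite eqxx phi_le ?mul0r// ltW.
  by rewrite phi_ge// gt_eqF// (lt_le_trans hnu).
have tangent := local_min_on_tangent hnm hlambda hnu hf_convex hf_lipschitz hmin Phi_rank.
have [G [Gsub XG GX]] := subgradient_normal_to_tangent hnm hf_convex tangent.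
have [U [V [x [y [[UO VO] x0 xn XE GE]]]]] := svd_orthogonal_pair hnm XG GX.
have xE : singval Xbar = x by rewrite XE singval_svd.
have yL : forall i, `|y i 0| <= L.
  by apply: (subdiff_lipschitz_bound hnm UO VO hf_lipschitz (X := Xbar)); rewrite -GE.
have xy i : x i 0 * y i 0 = 0.
  move: XG; rewrite XE GE !trmx_mul trmxK !mulmxA -(mulmxA _ U^T) UO mulmx1.
  rewrite -(mulmxA V) tr_diagm_mul// => /(congr1 (fun A => (V^T *m A *m V) i i)) /=.
  rewrite !mulmxA VO mul1mx -mulmxA VO mulmx1 mulmx0 mul0mx.
  by rewrite !mxE eqxx mulr1n.
pose d i : 'I_2 := if x i 0 == 0 then 0 else 1.
pose s : 'cV[R]_n := \col_i (if x i 0 == 0 then - (nu / lambda * y i 0) else 1).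
exists d => [i|].
  rewrite /active /= /d; have := gap i; rewrite xE => -[->|xi].
    rewrite eqxx /theta /= mul0r; apply/esym/max_idPl; by rewrite sub0r oppr_le0.
  rewrite gt_eqF ?(lt_le_trans hnu)// /theta /=; apply/esym/max_idPr.
  by rewrite subr_ge0 ler_pdivlMr// mul1r.
exists (U, V), G, s; split => //.
- by split => //=; rewrite xE.
- rewrite xE; apply: subdiff_l1norm => // i; rewrite mxE.
    case: eqP => _; last by rewrite normr1.
    rewrite normrN normrM ger0_norm; last by rewrite divr_ge0// ltW.
    rewrite mulrAC ler_pdivrMr// mul1r (le_trans (ler_wpM2l (ltW hnu) (yL i)))//.
    by rewrite -ler_pdivlMr// ltW.
  by move=> /negbTE ->.
have -> : U^T *m G *m V = diagm y.
  by rewrite GE !mulmxA UO mul1mx -mulmxA VO mulmx1.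
rewrite -diagmZ -diagmD.
rewrite (_ : \sum_i _ = diagm (\col_i (derive1 (theta nu (d i)) (x i 0)))); last first.
  apply/matrixP => i j; rewrite summxE xE mxE.
  under eq_bigr do rewrite !mxE.
  case: eqP => ij; last by rewrite big1// => k _; rewrite mulr0.
  rewrite (bigD1 j)//= big1 ?addr0; first by rewrite mxE eqxx mulr1.
  by move=> k /negbTE kj; rewrite eq_sym kj mulr0.
rewrite -diagmZ; congr diagm; apply/colP => i; rewrite !mxE derive1_theta /d.
have [xi0|xi0] := eqVneq (x i 0) 0 => /=.
  rewrite mulr0; field; by rewrite !gt_eqF.
have /eqP := xy i; rewrite mulf_eq0 (negbTE xi0) /= => /eqP ->.
by rewrite add0r mulr1.
Qed.
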